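(* Let $X_1$ and $X_2$ be two strong fuzzy incidence graphs without isolated vertices, with vertex sets $V_1$ and $V_2$, and let $D_1$ and $D_2$ be strong incidence dominating sets of $X_1$ and $X_2$ respectively. Let $X=X_1\diamond X_2$ be the tensor product. Then $D_1\times V_2$ and $V_1\times D_2$ are strong incidence dominating sets of $X$, and $$\gamma_{IS}(X)\le \min\{W(D_1\times V_2),\,W(V_1\times D_2)\}.$$
   Context: Fuzzy incidence graphs. All graphs are finite, simple and undirected; $\wedge$ denotes minimum. A fuzzy incidence graph (FIG) $X=(V,E,I,\varepsilon,\rho,\eta)$ consists of a nonempty finite vertex set $V$, a set $E$ of edges $xy=yx$ ($x\neq y$ in $V$), a set $I$ of (incidence) pairs $(x,xy)$ with $xy\in E$ and $x$ an endpoint of $xy$, and functions $\varepsilon:V\to(0,1]$, $\rho:E\to(0,1]$, $\eta:I\to(0,1]$ with $\rho(xy)\le\varepsilon(x)\wedge\varepsilon(y)$ for all $xy\in E$ and $\eta(x,xy)\le\varepsilon(x)\wedge\rho(xy)$ for all $(x,xy)\in I$ (vertices, edges, pairs of weight $0$ are regarded as absent). The number $\eta(x,xy)$ is the weight of the pair $(x,xy)$. Strong pairs. For $(a,ab)\in I$, an incidence path from $a$ to $ab$ in $X\setminus(a,ab)$ is a sequence $x_0=a,(x_0,x_0x_1),x_0x_1,(x_1,x_0x_1),x_1,\dots,x_k=b,(b,ab),ab$ with $k\ge2$, the vertices $x_0,\dots,x_k$ distinct, and all listed edges in $E$ and pairs in $I$; its incidence strength is the minimum weight of its pairs. $ICONN_{X\setminus(a,ab)}(a,ab)$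 is the maximum incidence strength over all such paths ($0$ if there are none). The pair $(a,ab)$ is strong if $\eta(a,ab)\ge ICONN_{X\setminus(a,ab)}(a,ab)$. A strong fuzzy incidence graph (SFIG) is a FIG all of whose pairs are strong. Domination. In a FIG $X$, a vertex $y$ is a strong incidence neighbor of $x$ if $xy\in E$ and both $(x,xy),(y,xy)$ are in $I$ and strong; $N_{IS}(x)$ is the set of strong incidence neighbors of $x$; $x$ is isolated if $N_{IS}(x)=\emptyset$. A set $D\subseteq V$ is a strong incidence dominating set (SIDS) if every $x\in V\setminus D$ is a strong incidence neighbor of some $y\in D$. Its weight is $W(D)=\sum_{x\in D}\min_{y\in N_{IS}(x)}\eta(x,xy)$ (an isolated vertex contributes $0$). The strong incidence domination number $\gamma_{IS}(X)$ is the minimum weight of a SIDS of $X$. Tensor product. For FIGs $X_i=(V_i,E_i,I_i,\varepsilon_i,\rho_i,\eta_i)$, $i=1,2$, the tensor product $X_1\diamond X_2=(V,E,I,\varepsilon,\rho,\eta)$ has $V=V_1\times V_2$; $E=\{(a_1,b_1)(a_2,b_2): a_1a_2\in E_1\text{ and }b_1b_2\in E_2\}$; $I$ is the set of pairs $((a_1,b_1),(a_1,b_1)(a_2,b_2))$ with $(a_1,a_1a_2),(a_2,a_1a_2)\in I_1$ and $(b_1,b_1b_2),(b_2,b_1b_2)\in I_2$; $\varepsilon(a,b)=\varepsilon_1(a)\wedge\varepsilon_2(b)$; $\rho((a_1,b_1)(a_2,b_2))=\rho_1(a_1a_2)\wedge\rho_2(b_1b_2)$; $\eta((a_1,b_1),(a_1,b_1)(a_2,b_2))=\eta_1(a_1,a_1a_2)\wedge\eta_2(b_1,b_1b_2)$.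 In the claim, $W$ is the weight in $X_1\diamond X_2$. *)

(* Defs.v *)
From mathcomp Require Import all_boot all_order all_algebra.
From mathcomp Require Import reals.

Set Implicit Arguments.
Unset Strict Implicit.
Unset Printing Implicit Defensive.

Import Order.TTheory GRing.Theory Num.Theory.
Local Open Scope ring_scope.

(* The edge xy is represented by the ordered pairs (x, y) and (y, x), and the
   incidence pair (x, xy) by the ordered pair (x, y): [inc x y] means that
   (x, xy) is in I and [eta x y] is its weight.  The values of [rho] and [eta]
   outside E and I are irrelevant. *)
Record fig (R : realType) (V : finType) := Fig {
  edge : rel V;
  inc : rel V;
  eps : V -> R;
  rho : V -> V -> R;
  eta : V -> V -> R;
  fig_nonempty : (0 < #|V|)%N;
  edge_sym : symmetric edge;
  edge_irrefl : irreflexive edge;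
  inc_edge : forall x y, inc x y -> edge x y;
  rho_sym : forall x y, edge x y -> rho x y = rho y x;
  eps_range : forall x, 0 < eps x <= 1;
  rho_range : forall x y, edge x y -> 0 < rho x y <= 1;
  eta_range : forall x y, inc x y -> 0 < eta x y <= 1;
  rho_le : forall x y, edge x y -> rho x y <= Num.min (eps x) (eps y);
  eta_le : forall x y, inc x y -> eta x y <= Num.min (eps x) (rho x y)
}.

Section Domination.
Variables (R : realType) (V : finType) (X : fig R V).

Definition inc_step (x y : V) : bool := [&& edge X x y, inc X x y & inc X y x].

(* [p] is the sequence x_1, ..., x_k of a path with x_0 = a and x_k = b.  Since
   k >= 2 and the vertices are distinct, such a path never uses (a, ab). *)
Definition inc_path (a b : V) (p : seq V) : bool :=
  [&& (2 <= size p)%N, uniq (a :: p), path inc_step a p, last a p == b,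
      edge X a b & inc X b a].

(* [zip (a :: p) p] lists the (x_i, x_{i+1}); the last pair (b, ab) serves as
   the initial value of the minimum. *)
Definition inc_strength (a b : V) (p : seq V) : R :=
  \big[Num.min/eta X b a]_(e <- zip (a :: p) p)
    Num.min (eta X e.1 e.2) (eta X e.2 e.1).

(* The vertices being distinct, every path has at most #|V| vertices. *)
Definition iconn (a b : V) : R :=
  \big[Num.max/0]_(p : {bseq #|V| of V} | inc_path a b p) inc_strength a b p.

Definition strong_pair (a b : V) : bool :=
  inc X a b && (iconn a b <= eta X a b).

Definition sfig : Prop := forall a b, inc X a b -> strong_pair a b.

Definition nis (x : V) : {set V} :=
  [set y | [&& edge X x y, strong_pair x y & strong_pair y x]].

Definition isolated (x : V) : bool := nis x == set0.

Definition sids (D : {set V}) : bool :=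
  [forall x, (x \notin D) ==> [exists y in D, x \in nis y]].

(* As all weights of pairs are at most 1, the initial value 1 does not affect
   the minimum over a nonempty set of neighbors. *)
Definition min_weight (x : V) : R :=
  if isolated x then 0 else \big[Num.min/1]_(y in nis x) eta X x y.

Definition sids_weight (D : {set V}) : R := \sum_(x in D) min_weight x.

(* The whole vertex set is a SIDS, so the initial value is one of the weights
   over which the minimum is taken. *)
Definition gamma_is : R :=
  \big[Num.min/sids_weight [set: V]]_(D : {set V} | sids D) sids_weight D.

End Domination.

Section Tensor.
Variables (R : realType) (V1 V2 : finType) (X1 : fig R V1) (X2 : fig R V2).

Definition tensor_edge : rel (V1 * V2) :=
  fun p q => edge X1 p.1 q.1 && edge X2 p.2 q.2.

Definition tensor_inc : rel (V1 * V2) :=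
  fun p q => [&& inc X1 p.1 q.1, inc X1 q.1 p.1, inc X2 p.2 q.2
               & inc X2 q.2 p.2].

Definition tensor_eps (p : V1 * V2) : R := Num.min (eps X1 p.1) (eps X2 p.2).

Definition tensor_rho (p q : V1 * V2) : R :=
  Num.min (rho X1 p.1 q.1) (rho X2 p.2 q.2).

Definition tensor_eta (p q : V1 * V2) : R :=
  Num.min (eta X1 p.1 q.1) (eta X2 p.2 q.2).

Lemma tensor_nonempty : (0 < #|{: V1 * V2}|)%N.
Proof. by rewrite card_prod muln_gt0 (fig_nonempty X1) (fig_nonempty X2). Qed.

Lemma tensor_edge_sym : symmetric tensor_edge.
Proof.
by move=> p q; rewrite /tensor_edge (edge_sym X1 p.1) (edge_sym X2 p.2).
Qed.

Lemma tensor_edge_irrefl : irreflexive tensor_edge.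
Proof. by move=> p; rewrite /tensor_edge edge_irrefl. Qed.

Lemma tensor_inc_edge p q : tensor_inc p q -> tensor_edge p q.
Proof. by case/and4P=> /inc_edge e1 _ /inc_edge e2 _; apply/andP. Qed.

Lemma tensor_rho_sym p q :
  tensor_edge p q -> tensor_rho p q = tensor_rho q p.
Proof.
by case/andP=> e1 e2; rewrite /tensor_rho (rho_sym e1) (rho_sym e2).
Qed.

Lemma min_range (a b : R) :
  0 < a <= 1 -> 0 < b <= 1 -> 0 < Num.min a b <= 1.
Proof.
by case/andP=> a0 a1 /andP[b0 _]; rewrite lt_min a0 b0 ge_min a1.
Qed.

Lemma tensor_eps_range p : 0 < tensor_eps p <= 1.
Proof. by apply: min_range; apply: eps_range. Qed.

Lemma tensor_rho_range p q : tensor_edge p q -> 0 < tensor_rho p q <= 1.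
Proof. by case/andP=> e1 e2; apply: min_range; apply: rho_range. Qed.

Lemma tensor_eta_range p q : tensor_inc p q -> 0 < tensor_eta p q <= 1.
Proof. by case/and4P=> i1 _ i2 _; apply: min_range; apply: eta_range. Qed.

Lemma min_le_min (a b c d a' b' : R) :
  a <= Num.min c d -> b <= Num.min a' b' ->
  Num.min a b <= Num.min (Num.min c a') (Num.min d b').
Proof.
rewrite !le_min !ge_min => /andP[-> ->] /andP[-> ->].
by rewrite !orbT.
Qed.

Lemma tensor_rho_le p q :
  tensor_edge p q -> tensor_rho p q <= Num.min (tensor_eps p) (tensor_eps q).
Proof. by case/andP=> e1 e2; apply: min_le_min; apply: rho_le. Qed.

Lemma tensor_eta_le p q :
  tensor_inc p q -> tensor_eta p q <= Num.min (tensor_eps p) (tensor_rho p q).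
Proof. by case/and4P=> i1 _ i2 _; apply: min_le_min; apply: eta_le. Qed.

Definition tensor : fig R (V1 * V2)%type :=
  Fig tensor_nonempty tensor_edge_sym tensor_edge_irrefl tensor_inc_edge
      tensor_rho_sym tensor_eps_range tensor_rho_range tensor_eta_range
      tensor_rho_le tensor_eta_le.

End Tensor.

(* Main.v *)
(** A path of incidence strength [s] in the tensor product from [(a1, b1)] to
    the edge [(a1, b1)(a2, b2)] projects to a walk in each factor whose pairs
    have weight at least [s].  Shortening the walk yields either a path
    witnessing [s <= ICONN] in the factor or the single step [a1 a2]; in both
    cases [s] is at most the weight of [(a1, a1a2)], as this pair is strong.
    So the tensor product of two SFIGs is an SFIG, and its strong incidence
    neighbors are the pairs of neighbors in the factors.  A vertex outside
    [D1 x V2] is then dominated coordinatewise: in the first coordinate by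
    [D1], in the second by any neighbor. *)

Require Import Defs.
From mathcomp Require Import all_boot all_order all_algebra.
From mathcomp Require Import reals.

Set Implicit Arguments.
Unset Strict Implicit.
Unset Printing Implicit Defensive.

Import Order.TTheory.
Local Open Scope ring_scope.

Section HeavyWalks.
Variables (R : realType) (V : finType) (X : fig R V).

(** A threshold imposed on each step, unlike a minimum over a whole path, passes directly to
    shortened walks and to projections. *)
Definition heavy_step (s : R) (x y : V) : bool :=
  [&& inc_step X x y, s <= eta X x y & s <= eta X y x].

Lemma heavy_pathE s a p :
  path (heavy_step s) a p =
  path (inc_step X) a p &&
  all (fun e => s <= Num.min (eta X e.1 e.2) (eta X e.2 e.1)) (zip (a :: p) p).
Proof.
elim: p a => //= x p IHp a; rewrite IHp /heavy_step le_min /=.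
by case: inc_step; case: path; rewrite ?andbF.
Qed.

Lemma le_inc_strength s a b p :
  (s <= inc_strength X a b p) =
  (s <= eta X b a) &&
  all (fun e => s <= Num.min (eta X e.1 e.2) (eta X e.2 e.1)) (zip (a :: p) p).
Proof.
rewrite /inc_strength; elim: (zip _ _) => [|e z IHz] /=.
  by rewrite big_nil andbT.
by rewrite big_cons le_min IHz andbCA.
Qed.

Lemma inc_strength_le_iconn a b p :
  inc_path X a b p -> inc_strength X a b p <= iconn X a b.
Proof.
(* The maximum ranges over sequences of bounded length; distinctness of the vertices gives the
   bound. *)
move=> pathp; have sz_p : (size p <= #|V|)%N.
  case/and5P: (pathp) => _ /andP[_ /card_uniqP <-] _ _ _.
  exact: max_card.
exact: (@le_bigmax_cond _ _ _ _ (Bseq sz_p)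
          (fun q : {bseq #|V| of V} => inc_path X a b q)
          (fun q => inc_strength X a b q)).
Qed.

(** The pair [(b, ab)] closing an incidence path need not occur on the walk, whence the separate
    bound on [eta X b a]. *)
Lemma heavy_walk_le s a b p :
  strong_pair X a b -> inc X b a -> s <= eta X b a ->
  path (heavy_step s) a p -> last a p = b -> s <= eta X a b.
Proof.
case/andP=> ab_inc strong_ab ba_inc s_ba walk_p last_p.
have ab_edge := inc_edge ab_inc.
move: last_p; case: (shortenP walk_p) => q path_q uniq_q _ last_q.
(* Length 0 would make [ab] a loop, length 1 is the step [ab] itself, and length at least 2 is what
   [inc_path] demands. *)
case: q => [|x [|y q]] in path_q uniq_q last_q *.
- by move: ab_edge; rewrite -last_q /= edge_irrefl.
- by move: path_q; rewrite -last_q /= andbT => /and3P[].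
- move: path_q; rewrite heavy_pathE => /andP[path_q heavy_q].
  apply: le_trans strong_ab.
  apply: (le_trans _ (inc_strength_le_iconn (p := [:: x, y & q]) _)).
    by rewrite le_inc_strength s_ba.
  by rewrite /inc_path uniq_q path_q last_q eqxx ab_edge ba_inc.
Qed.

Lemma nis_sym x y : (x \in nis X y) = (y \in nis X x).
Proof. by rewrite !inE edge_sym [strong_pair X y x && _]andbC. Qed.

Lemma nis_nonempty x : ~~ isolated X x -> exists y, x \in nis X y.
Proof. by move=> /set0Pn[y xy]; exists y; rewrite nis_sym. Qed.

Lemma gamma_is_le D : sids X D -> gamma_is X <= sids_weight X D.
Proof. by move=> dD; apply: bigmin_le_cond. Qed.

End HeavyWalks.

Section TensorStrong.
Variables (R : realType) (V1 V2 : finType) (X1 : fig R V1) (X2 : fig R V2).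
Hypotheses (sX1 : sfig X1) (sX2 : sfig X2).

Lemma heavy_step_tensor s p q :
  heavy_step (tensor X1 X2) s p q =
  heavy_step X1 s p.1 q.1 && heavy_step X2 s p.2 q.2.
Proof.
rewrite /heavy_step /inc_step /= /tensor_edge /tensor_inc /tensor_eta !le_min.
by do ![case: (edge _ _ _) | case: (inc _ _ _) | case: (_ <= _)].
Qed.

Lemma tensor_sfig : sfig (tensor X1 X2).
Proof.
move=> a b ab_inc; rewrite /strong_pair ab_inc /=.
apply: bigmax_le => [|p /and5P[_ _ path_p /eqP last_p _]].
  (* This is the initial value 0 of the maximum. *)
  by case/andP: (tensor_eta_range ab_inc) => /ltW.
(* With the strength itself as threshold, [s <= s] unfolds into a bound on every pair of the
   path. *)
set s := inc_strength _ _ _ _; have := lexx s.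
rewrite {2}/s le_inc_strength => /andP[/= s_ba heavy_p].
have: path (heavy_step (tensor X1 X2) s) a p by rewrite heavy_pathE path_p.
case/and4P: ab_inc => ab1 ba1 ab2 ba2.
move: s_ba; rewrite /tensor_eta !le_min => /andP[s_ba1 s_ba2] walk_p.
apply/andP; split.
(* Distinct vertices may share a coordinate, so the projection is only a walk. *)
- apply: (heavy_walk_le (p := map fst p) (sX1 ab1)) => //.
    apply: homo_path walk_p => x y; rewrite heavy_step_tensor.
    by case/andP.
  by rewrite last_map last_p.
- apply: (heavy_walk_le (p := map snd p) (sX2 ab2)) => //.
    apply: homo_path walk_p => x y; rewrite heavy_step_tensor.
    by case/andP.
  by rewrite last_map last_p.
Qed.

(** Edges and incidences suffice here, since [tensor_sfig] makes every pair strong. *)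
Lemma nis_tensor x y :
  x.1 \in nis X1 y.1 -> x.2 \in nis X2 y.2 -> x \in nis (tensor X1 X2) y.
Proof.
rewrite !inE => /and3P[e1 /andP[i1 _] /andP[j1 _]].
case/and3P=> e2 /andP[i2 _] /andP[j2 _].
apply/and3P; split; first exact/andP.
- by apply: tensor_sfig; apply/and4P.
- by apply: tensor_sfig; apply/and4P.
Qed.

Lemma sids_setXT (D1 : {set V1}) :
  (forall y, ~~ isolated X2 y) -> sids X1 D1 ->
  sids (tensor X1 X2) (setX D1 [set: V2]).
Proof.
move=> niX2 /forallP dD1; apply/forallP=> x; apply/implyP.
rewrite !inE andbT => /(implyP (dD1 _))/exists_inP[y1 y1D xy1].
have [y2 xy2] := nis_nonempty (niX2 x.2).
apply/exists_inP; exists (y1, y2); first by rewrite !inE y1D.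
by apply: nis_tensor.
Qed.

Lemma sids_setTX (D2 : {set V2}) :
  (forall x, ~~ isolated X1 x) -> sids X2 D2 ->
  sids (tensor X1 X2) (setX [set: V1] D2).
Proof.
move=> niX1 /forallP dD2; apply/forallP=> x; apply/implyP.
rewrite !inE /= => /(implyP (dD2 _))/exists_inP[y2 y2D xy2].
have [y1 xy1] := nis_nonempty (niX1 x.1).
apply/exists_inP; exists (y1, y2); first by rewrite !inE y2D.
by apply: nis_tensor.
Qed.

End TensorStrong.

Theorem theorem5p6 (R : realType) (V1 V2 : finType)
    (X1 : fig R V1) (X2 : fig R V2) (D1 : {set V1}) (D2 : {set V2})
    (sX1 : sfig X1) (sX2 : sfig X2)
    (niX1 : forall x : V1, ~~ isolated X1 x)
    (niX2 : forall y : V2, ~~ isolated X2 y)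
    (dD1 : sids X1 D1) (dD2 : sids X2 D2) :
  [/\ sids (tensor X1 X2) (setX D1 [set: V2]),
      sids (tensor X1 X2) (setX [set: V1] D2)
    & (gamma_is (tensor X1 X2) <=
        Num.min (sids_weight (tensor X1 X2) (setX D1 [set: V2]))
                (sids_weight (tensor X1 X2) (setX [set: V1] D2)))%R].
Proof.
have dX1 := sids_setXT sX1 sX2 niX2 dD1.
have dX2 := sids_setTX sX1 sX2 niX1 dD2.
by split=> //; rewrite le_min !gamma_is_le.
Qed.
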